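(* Let $G$ be a directed graph, and let $\mathrm{opt}(G)$ denote the set of vertices covered by some fixed maximum cardinality matching of $G$ (a matching being a collection of vertex-disjoint directed cycles of $G$ of an allowed type, and its cardinality the number of vertices it covers). Let $p_1,\dots,p_k$ be a probability distribution over players $1,\dots,k$; each vertex of $G$ is assigned independently to player $i$ with probability $p_i$, and $H_i$ is the subgraph of $G$ induced by the vertices assigned to player $i$. Assume that one of the following holds: (1) matchings are restricted to 2-cycles, and $p_i\le 1/2$ for each player $i\in[k]$; or (2) matchings are restricted to cycles of length at most a constant $L$, and for each player $i\in[k]$, $1/p_i$ is an integer. Then for any $\delta>0$, \[\Pr\left[\forall i\in[k],\ |\mathrm{opt}(H_i)| - |\mathrm{opt}(G)\restriction H_i| < O\left(\sqrt{|\mathrm{opt}(G)|\ln\tfrac{k}{\delta}}\right)\right]\ge 1-\delta,\] where the $O(\cdot)$ hides a constant depending only on the maximum allowed cycle length.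
   Context: For a graph $H$, $\mathrm{opt}(H)$ is the vertex set of a maximum cardinality matching of $H$ (under the same restriction on allowed cycles), so $|\mathrm{opt}(H)|$ is the maximum number of vertices of $H$ that can be covered by vertex-disjoint allowed cycles of $H$. $\mathrm{opt}(G)\restriction H_i$ denotes the set of vertices of $H_i$ that belong to the fixed set $\mathrm{opt}(G)$. The probability is over the random assignment of vertices to players. *)

(* Defs.v *)
From HB Require Import structures.
From mathcomp Require Import all_boot all_order all_algebra.
From mathcomp Require Import boolp reals exp.
Set Implicit Arguments.
Unset Strict Implicit.
Unset Printing Implicit Defensive.
Import Order.TTheory GRing.Theory Num.Theory.

Inductive cycle_restriction : Type :=
  | TwoCycles
  | CyclesUpTo of nat.

Definition max_cycle_length (r : cycle_restriction) : nat :=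
  match r with TwoCycles => 2 | CyclesUpTo L => L end.

Definition allowed_length (r : cycle_restriction) (l : nat) : bool :=
  match r with TwoCycles => l == 2 | CyclesUpTo L => 0 < l <= L end.

Section Matchings.
Variables (r : cycle_restriction) (V : finType) (e : rel V).

(* A cycle is the list of its vertices. That the concatenated list has no
   repetition says both that each cycle is simple and that distinct cycles are
   vertex-disjoint. If [e] has self-loops, they count as cycles of length 1. *)
Definition is_matching (M : seq (seq V)) : bool :=
  all (fun c => allowed_length r (size c) && cycle e c) M && uniq (flatten M).

Definition covered (M : seq (seq V)) : {set V} := [set x in flatten M].

Definition is_maximum_matching (M : seq (seq V)) : Prop :=
  is_matching M /\
  forall M', is_matching M' -> #|covered M'| <= #|covered M|.

Definition opt_size : nat :=
  \max_(S : {set V} | `[< exists2 M, is_matching M & S = covered M >]) #|S|.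

End Matchings.

Definition induced (V : finType) (e : rel V) (S : {set V}) :
  rel {x : V | x \in S} := relpre val e.
Arguments induced {V} e S _ _.

Definition assigned (V : finType) (k : nat) (f : {ffun V -> 'I_k}) (i : 'I_k) :
  {set V} := [set x | f x == i].

(* Probability of [E] when the values [f x] are independent, each of law [p]. *)
Definition assignment_Pr (R : realType) (V : finType) (k : nat) (p : 'I_k -> R)
    (E : pred {ffun V -> 'I_k}) : R :=
  (\sum_(f | E f) \prod_(x : V) p (f x))%R.

(* Main.v *)
Require Import Defs.
From HB Require Import structures.
From mathcomp Require Import all_boot all_order all_algebra.
From mathcomp Require Import ring lra.
From mathcomp Require Import boolp reals sequences exp.
Set Implicit Arguments.
Unset Strict Implicit.
Unset Printing Implicit Defensive.
Import Order.TTheory GRing.Theory Num.Theory.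
Local Open Scope ring_scope.

(* Let [H] be the random vertex set of player [i], [O] the covered set of the
   fixed maximum matching, and [h H := opt(H) - |O :&: H|].

   The mean of [h] is at most 0. If [1 / p_i = m], then [H] is distributed as one
   class of a uniform [m]-colouring, and the classes have disjoint matchings. For
   2-cycles and [p_i <= 1/2], induct on the vertex set [S]: a vertex met by every
   maximum matching contributes 2 to [opt(S)] and at most [2 p_i] to the mean of
   [opt(H :&: S)]; if there is none, then, by Gallai's lemma, [S] either splits
   into two parts with no edge between them, or [opt(S) >= |S| - 1]. In the last
   case [opt(H :&: S)] is at most [|H :&: S|] rounded down to an even number, whose
   mean is known from that of [(-1) ^ |H :&: S|].

   If [P] is an optimal matching of [H], then
   [h H - h H' <= \sum_(j in H (+) H') (L [j \in P] + [j \in O])] for all [H'],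
   and the squares of these weights sum to at most [(L + 1)^2 |O|] because
   [|P| <= |O|]. A Talagrand-type inequality then gives a Gaussian upper tail whose
   variance depends on [|O|] only, and a union bound over players concludes. *)

(** * Product measures and a transport inequality *)

Section Resampling.
Variables (V Omega : finType).

Definition resample (v : V) (t : Omega) (f : {ffun V -> Omega}) :
  {ffun V -> Omega} := [ffun x => if x == v then t else f x].

Lemma resampleE v t (f : {ffun V -> Omega}) x :
  resample v t f x = if x == v then t else f x.
Proof. by rewrite ffunE. Qed.

Lemma resampleK v t (f : {ffun V -> Omega}) :
  resample v (f v) (resample v t f) = f.
Proof. by apply/ffunP => x; rewrite !resampleE; case: eqP => [->|]. Qed.

End Resampling.

Section ProductExpectation.
Variables (R : realType) (V Omega : finType) (mu : Omega -> R).
Hypothesis mu_ge0 : forall t, 0 <= mu t.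
Hypothesis mu_sum1 : \sum_t mu t = 1.

Definition expect (phi : {ffun V -> Omega} -> R) : R :=
  \sum_(f : {ffun V -> Omega}) (\prod_x mu (f x)) * phi f.

Lemma weight_ge0 (f : {ffun V -> Omega}) : 0 <= \prod_x mu (f x).
Proof. exact: prodr_ge0. Qed.

Lemma expect_prod (F : V -> Omega -> R) :
  expect (fun f => \prod_x F x (f x)) = \prod_x \sum_t mu t * F x t.
Proof.
by rewrite bigA_distr_bigA; apply: eq_bigr => f _; rewrite big_split.
Qed.

Lemma eq_expect phi psi : phi =1 psi -> expect phi = expect psi.
Proof. by move=> eq_phi; apply: eq_bigr => f _; rewrite eq_phi. Qed.

Lemma expect_cst c : expect (fun=> c) = c.
Proof.
rewrite /expect -mulr_suml -[RHS]mul1r; congr (_ * _).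
rewrite -(bigA_distr_bigA (fun _ t => mu t)) /=.
by rewrite big1 // => x _; rewrite mu_sum1.
Qed.

Lemma expectD phi psi :
  expect (fun f => phi f + psi f) = expect phi + expect psi.
Proof. by rewrite -big_split; apply: eq_bigr => f _; rewrite mulrDr. Qed.

Lemma expectZ c phi : expect (fun f => c * phi f) = c * expect phi.
Proof. by rewrite mulr_sumr; apply: eq_bigr => f _; rewrite mulrCA. Qed.

Lemma expectB phi psi :
  expect (fun f => phi f - psi f) = expect phi - expect psi.
Proof. by rewrite -sumrB; apply: eq_bigr => f _; rewrite mulrBr. Qed.

Lemma expect_sum (I : Type) (r : seq I) (P : pred I)
    (phi : I -> {ffun V -> Omega} -> R) :
  expect (fun f => \sum_(i <- r | P i) phi i f)
  = \sum_(i <- r | P i) expect (phi i).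
Proof. by rewrite exchange_big; apply: eq_bigr => f _; rewrite mulr_sumr. Qed.

Lemma le_expect phi psi :
  (forall f, phi f <= psi f) -> expect phi <= expect psi.
Proof.
by move=> le_phi; apply: ler_sum => f _; rewrite ler_wpM2l ?weight_ge0.
Qed.

(* (f, t) |-> (f with t at v, f v) is a weight-preserving involution. *)
Lemma expect_resample v phi :
  expect phi = \sum_t mu t * expect (fun f => phi (resample v t f)).
Proof.
transitivity (\sum_(a : {ffun V -> Omega} * Omega)
                (\prod_x mu (a.1 x)) * mu a.2 * phi a.1).
  rewrite -(pair_bigA _ (fun (f : {ffun V -> Omega}) t =>
    (\prod_x mu (f x)) * mu t * phi f)) /=.
  apply: eq_bigr => f _.
  by under [RHS]eq_bigr do rewrite mulrAC; rewrite -mulr_sumr mu_sum1 mulr1.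
pose sw (a : {ffun V -> Omega} * Omega) := (resample v a.2 a.1, a.1 v).
have swK : involutive sw.
  by move=> [f t]; rewrite /sw /= resampleK resampleE eqxx.
rewrite (reindex_inj (inv_inj swK)) /=.
under [RHS]eq_bigr do rewrite mulr_sumr.
rewrite exchange_big /=.
rewrite -(pair_bigA _ (fun (f : {ffun V -> Omega}) t =>
  (\prod_x mu (resample v t f x)) * mu (f v) * phi (resample v t f))) /=.
apply: eq_bigr => f _; apply: eq_bigr => t _.
rewrite mulrA; congr (_ * _).
rewrite (bigD1 v) // [in RHS](bigD1 v) //= resampleE eqxx -mulrA; congr (_ * _).
rewrite mulrC; congr (_ * _); apply: eq_bigr => x /negPf xv.
by rewrite resampleE xv.
Qed.

Lemma expect_coord v (psi : Omega -> R) :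
  expect (fun f => psi (f v)) = \sum_t mu t * psi t.
Proof.
rewrite (expect_resample v); apply: eq_bigr => t _; congr (_ * _).
under eq_expect do rewrite resampleE eqxx.
exact: expect_cst.
Qed.

(* [w := min (2 d) 1] minimises the exponent; then [expR x <= (1 - x)^-1]. *)
Lemma expR_transport_le (d : R) : 0 <= d ->
  exists2 w, 0 <= w <= 1 & expR ((1 - w) * d + w ^+ 2 / 4) <= 1 + d.
Proof.
move=> d0.
have expR_le x y : x < 1 -> 1 <= y * (1 - x) -> expR x <= y.
  move=> x1 xy; rewrite -[expR x]invrK -expRN.
  have px : 0 < 1 - x by rewrite subr_gt0.
  have le1 : (expR (- x))^-1 <= (1 - x)^-1.
    by rewrite lef_pV2 ?posrE ?expR_gt0 ?expR_ge1Dx.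
  by rewrite (le_trans le1) // -div1r ler_pdivrMr.
have [d1|d1] := leP (2 * d) 1.
  exists (2 * d); first by rewrite d1 mulr_ge0.
  (* The exponent is [d - d ^+ 2], and [(1 + d) * (1 - d + d ^+ 2) = 1 + d ^+ 3]. In the other case
     it is [1 / 4], and [(1 + d) * (3 / 4) >= 1] because [d > 1 / 2]. *)
  by apply: expR_le; nra.
by exists 1; [rewrite ler01 lexx | apply: expR_le; nra].
Qed.

(* A Talagrand-type inequality in the dual form of Maurey and Samson. Each
   coordinate is integrated out by applying the induction hypothesis to a convex
   combination of two sections of [h]: section [s], and the section of least
   mean. *)
Lemma expect_exp_certificate (s : seq V) (g h : {ffun V -> Omega} -> R)
    (a : V -> {ffun V -> Omega} -> R) :
  uniq s -> (forall j f, 0 <= a j f) ->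
  (forall f f' : {ffun V -> Omega},
    g f - \sum_(j <- s | f j != f' j) a j f <= h f') ->
  expect (fun f => expR (g f - \sum_(j <- s) a j f ^+ 2)) <= expR (expect h).
Proof.
elim: s g h a => [|v s IH] g h a /=.
  move=> _ _ gh.
  have gE f : g f <= expect h.
    rewrite -[g f]expect_cst; apply: le_expect => f'.
    by have := gh f f'; rewrite big_nil subr0.
  rewrite -[leRHS]expect_cst; apply: le_expect => f.
  by rewrite big_nil subr0 ler_expR.
case/andP => vs us a0 gh.
pose m t := expect (fun f => h (resample v t f)).
have Eh : expect h = \sum_t mu t * m t by rewrite (expect_resample v).
have [t1 _|Om0] := pickP (@predT Omega); last first.
  by have := mu_sum1; rewrite big_pred0 // => /eqP; rewrite eq_sym oner_eq0.
pose t0 := [arg min_(t < t1) m t]%O.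
have t0P t : m t0 <= m t by rewrite /t0; case: arg_minP => // i _; apply.
rewrite (expect_resample v).
(* This bound is affine in [m t]: averaging over [t] turns [m t] into [expect h], and
   [1 + x <= expR x] concludes. *)
have key t : expect (fun f => expR (g (resample v t f)
    - \sum_(j <- v :: s) a j (resample v t f) ^+ 2))
    <= expR (m t0) * (1 + (m t - m t0)).
  have [|w /andP[w0 w1] wP] := @expR_transport_le (m t - m t0).
    by rewrite subr_ge0.
  apply: (@le_trans _ _ (expR (w ^+ 2 / 4) * expR ((1 - w) * m t + w * m t0)));
    last first.
    rewrite -expRD.
    have -> : w ^+ 2 / 4 + ((1 - w) * m t + w * m t0)
      = m t0 + ((1 - w) * (m t - m t0) + w ^+ 2 / 4) by ring.
    by rewrite expRD ler_pM2l ?expR_gt0.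
  have -> : (1 - w) * m t + w * m t0 = expect (fun f =>
      (1 - w) * h (resample v t f) + w * h (resample v t0 f)).
    by rewrite expectD !expectZ.
  (* Only section [t0], of weight [w], can change the value at [v], so at most [w * a v] is charged
     there. *)
  pose g' f := g (resample v t f) - w * a v (resample v t f).
  apply: (@le_trans _ _ (expR (w ^+ 2 / 4) * expect (fun f =>
      expR (g' f - \sum_(j <- s) a j (resample v t f) ^+ 2)))).
    rewrite -expectZ; apply: le_expect => f.
    rewrite -expRD ler_expR big_cons /g'.
    (* This gives [w * a v <= a v ^+ 2 + w ^+ 2 / 4], which trades the linear charge for a square
       and the factor [expR (w ^+ 2 / 4)]. *)
    have : 0 <= (a v (resample v t f) - w / 2) ^+ 2 by exact: sqr_ge0.
    by nra.
  rewrite ler_pM2l ?expR_gt0 //; apply: IH => // f f'.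
  have sumE t' : \sum_(j <- s | resample v t f j != resample v t' f' j)
      a j (resample v t f) = \sum_(j <- s | f j != f' j) a j (resample v t f).
    rewrite big_seq_cond [RHS]big_seq_cond; apply: eq_bigl => j.
    case js: (j \in s) => //=; rewrite !resampleE.
    by case: (j =P v) js => [->|//]; rewrite (negPf vs).
  have := gh (resample v t f) (resample v t f').
  have := gh (resample v t f) (resample v t0 f').
  rewrite !big_cons !sumE !resampleE !eqxx /= /g'.
  set A := a v _; set S := \sum_(j <- s | _) _.
  have A0 : 0 <= A by exact: a0.
  by case: ifP => _ ? ?; nra.
apply: (@le_trans _ _ (\sum_t mu t * (expR (m t0) * (1 + (m t - m t0))))).
  by apply: ler_sum => t _; apply: ler_wpM2l.
under eq_bigr do rewrite mulrCA mulrDr mulr1 mulrBr.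
rewrite -mulr_sumr big_split sumrB /= -mulr_suml mu_sum1 mul1r -Eh.
rewrite -[X in _ <= expR X](subrKC (m t0)) expRD ler_pM2l ?expR_gt0 //.
exact: expR_ge1Dx.
Qed.

End ProductExpectation.

(** * Set packings and Gallai's lemma *)

Section Packings.
Local Open Scope nat_scope.
Variables (V : finType) (F : {set {set V}}).
Implicit Types (P Q N : {set {set V}}) (S T A B : {set V}).

Definition packing (P : {set {set V}}) : bool := (P \subset F) && trivIset P.

(** Covered vertices are counted, not blocks, to match [opt_size]. *)
Definition nu (S : {set V}) : nat :=
  \max_(P : {set {set V}} | packing P && (cover P \subset S)) #|cover P|.

Lemma packing0 : packing set0.
Proof. by rewrite /packing sub0set; apply/trivIsetP => A; rewrite inE. Qed.

Lemma nu_ge P S : packing P -> cover P \subset S -> #|cover P| <= nu S.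
Proof. by move=> pP PS; apply: (bigop.bigmax_sup P); rewrite ?pP. Qed.

(** The existential is informative, so that [optimal_cover] can select a witness for each
    assignment. *)
Lemma nuP S : {P | packing P & cover P \subset S /\ nu S = #|cover P|}.
Proof.
have : 0 < #|[pred P | packing P && (cover P \subset S)]|.
  by apply/card_gt0P; exists set0; rewrite inE packing0 /cover big_set0 sub0set.
by case/(eq_bigmax_cond (fun P => #|cover P|)) => P /andP[pP PS] nuE; exists P.
Qed.

Lemma nu_le_card S : nu S <= #|S|.
Proof. by apply/bigmax_leqP => P /andP[_ /subset_leq_card]. Qed.

Lemma leq_nu S T : S \subset T -> nu S <= nu T.
Proof. by case: (nuP S) => P pP [PS ->] ST; rewrite nu_ge ?(subset_trans PS). Qed.

Lemma packingS P Q : P \subset Q -> packing Q -> packing P.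
Proof.
move=> PQ /andP[QF tQ]; rewrite /packing (subset_trans PQ QF).
exact: trivIsetS tQ.
Qed.

Lemma packingU P Q : packing P -> packing Q -> [disjoint cover P & cover Q] ->
  packing (P :|: Q).
Proof.
case/andP => PF tP /andP[QF tQ] dPQ; rewrite /packing subUset PF QF /=.
have sub A N : A \in N -> A \subset cover N by apply: bigcup_sup.
apply/trivIsetP => A B; rewrite !inE => /orP[] AP /orP[] BP AB.
- exact: (trivIsetP tP).
- exact: disjointW (sub _ _ AP) (sub _ _ BP) dPQ.
- by rewrite disjoint_sym; exact: disjointW (sub _ _ BP) (sub _ _ AP) dPQ.
- exact: (trivIsetP tQ).
Qed.

Lemma coverU (P Q : {set {set V}}) : cover (P :|: Q) = cover P :|: cover Q.
Proof. exact: bigcup_setU. Qed.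

Lemma cover1 (A : {set V}) : cover [set A] = A.
Proof. by rewrite /cover big_set1. Qed.

Lemma packing1 A : A \in F -> packing [set A].
Proof.
by move=> AF; rewrite /packing sub1set AF; apply/trivIsetP => B C;
  rewrite !inE => /eqP-> /eqP->; rewrite eqxx.
Qed.

Lemma leq_nuU S T : [disjoint S & T] -> nu S + nu T <= nu (S :|: T).
Proof.
case: (nuP S) (nuP T) => P pP [PS ->] [Q pQ [QT ->]] dST.
have dPQ := disjointW PS QT dST.
move: (dPQ); rewrite -setI_eq0 => /eqP PQ0.
rewrite -[leqLHS]subn0 -(@cards0 V) -PQ0 -cardsU -coverU.
by rewrite nu_ge ?packingU // coverU setUSS.
Qed.

Lemma leq_nu_sum (k : nat) (f : {ffun V -> 'I_k}) :
  \sum_(i < k) nu (assigned f i) <= nu setT.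
Proof.
(* Generalised to a list of distinct colours, so that disjoint classes can be added one at a
   time. *)
suff H (s : seq 'I_k) : uniq s ->
    \sum_(i <- s) nu (assigned f i) <= nu [set x | f x \in s].
  exact: leq_trans (H _ (index_enum_uniq _)) (leq_nu (subsetT _)).
elim: s => [|i s IH] /=; first by rewrite big_nil.
case/andP=> is_ us; rewrite big_cons.
apply: leq_trans (leq_add (leqnn _) (IH us)) _.
have dis : [disjoint assigned f i & [set x | f x \in s]].
  rewrite -setI_eq0; apply/eqP/setP => x; rewrite !inE.
  by case: eqP => [->|//]; rewrite (negPf is_).
apply: leq_trans (leq_nuU dis) (leq_nu _).
by apply/subsetP => x; rewrite !inE.
Qed.

(* Every vertex that leaves the ground set destroys at most one block. *)
Lemma nu_certificate (L : nat) P T : {in F, forall A : {set V}, #|A| <= L} ->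
  packing P -> #|cover P| <= nu T + L * #|cover P :\: T|.
Proof.
move=> FL pP; have /andP[PF tP] := pP.
pose Q := [set A in P | A \subset T].
have QP : Q \subset P by apply/subsetP => A; rewrite inE => /andP[].
have pQ := packingS QP pP.
have QT : cover Q \subset T.
  by apply/bigcupsP => A; rewrite inE => /andP[].
apply: leq_trans (leq_add (nu_ge pQ QT) (leqnn _)).
have /andP[_ tQ] := pQ.
rewrite -!sum1_card (big_trivIset _ tP) (big_trivIset _ tQ) /=.
have -> : \sum_(x in cover P :\: T) 1 = \sum_(A in P) #|A :\: T|.
  rewrite (eq_bigl (fun x => (x \in cover P) && (x \notin T))); last first.
    by move=> x; rewrite inE andbC.
  rewrite (big_trivIset_cond _ tP); apply: eq_bigr => A _.
  by rewrite -sum1_card; apply: eq_bigl => x; rewrite !inE andbC.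
rewrite big_distrr /=
  [X in _ <= X + _](eq_bigl (fun A => (A \in P) && (A \subset T)));
  last by move=> A; rewrite inE.
rewrite big_mkcondr -big_split /=; apply: leq_sum => A AP.
rewrite sum1_card; case: ifPn => [_|]; first by rewrite leq_addr.
case/subsetPn => x xA xT; rewrite add0n.
apply: leq_trans (FL _ (subsetP PF _ AP)) _.
by rewrite leq_pmulr // card_gt0; apply/set0Pn; exists x; rewrite inE xT.
Qed.

(** * Packings of pairs *)

Section Pairs.
Hypothesis F2 : {in F, forall A : {set V}, #|A| = 2}.

Lemma card_cover2 P : packing P -> #|cover P| = #|P| * 2.
Proof.
case/andP => PF /eqP <-; rewrite -sum_nat_const.
by apply: eq_bigr => A AP; rewrite F2 // (subsetP PF).
Qed.

Lemma nu_even S : ~~ odd (nu S).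
Proof. by case: (nuP S) => P pP [_ ->]; rewrite card_cover2 // oddM andbF. Qed.

Lemma nu_setD1 S v : nu S <= nu (S :\ v) + 2 * (v \in S).
Proof.
case: (nuP S) => P pP [PS ->].
apply: leq_trans (nu_certificate (L := 2) (S :\ v) _ pP) _.
  by move=> A AF; rewrite F2.
rewrite leq_add2l leq_mul2l /=.
have sub : cover P :\: (S :\ v) \subset (if v \in S then [set v] else set0).
  apply/subsetP => x; rewrite !inE negb_and negbK => /andP[/orP[/eqP->|xS] xP].
    by rewrite (subsetP PS v xP) ?inE.
    by rewrite (subsetP PS x xP) in xS.
apply: leq_trans (subset_leq_card sub) _.
by case: (v \in S); rewrite ?cards1 ?cards0.
Qed.

Section Gallai.
Variable S : {set V}.
Hypothesis inessential : forall v, v \in S -> nu (S :\ v) = nu S.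

(* No optimal packing misses both [u] and [v]. *)
Definition codependent (u v : V) : bool :=
  (u == v) || (nu (S :\ u :\ v) < nu S).

Lemma codependent_sym : symmetric codependent.
Proof. by move=> u v; rewrite /codependent eq_sym setDDl setUC -setDDl. Qed.

(** An optimal packing that misses both ends of [A] could be enlarged by [A]. *)
Lemma codependent_edge A : A \in F -> A \subset S ->
  {in A &, forall x y, codependent x y}.
Proof.
move=> AF AS x y xA yA; rewrite /codependent; case: eqVneq => //= xy.
rewrite ltnNge; apply/negP => le.
have AE : A = [set x; y].
  apply/esym/eqP; rewrite eqEcard cards2 xy F2 // andbT.
  by apply/subsetP => z; rewrite !inE => /orP[] /eqP->.
have [P pP [PS nuE]] := nuP (S :\ x :\ y).
have dAP : [disjoint A & cover P].
  rewrite disjoint_sym; apply/pred0P => z /=; rewrite AE !inE.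
  by apply/negP => /andP[/(subsetP PS)]; rewrite !inE => /and3P[/negPf-> /negPf->].
have pAP : packing (A |: P) by rewrite packingU ?packing1 ?cover1.
have cE : cover (A |: P) = A :|: cover P by rewrite coverU cover1.
have : #|cover (A |: P)| <= nu S.
  apply: nu_ge => //; rewrite cE subUset AS; apply: subset_trans PS _.
  by rewrite (subset_trans (subD1set _ _)) ?subD1set.
have dAP0 : A :&: cover P = set0 by apply/eqP; rewrite setI_eq0.
rewrite cE cardsU dAP0 cards0 subn0 F2 // -nuE.
by rewrite add2n => /leq_trans/(_ le); rewrite ltnNge leqnSn.
Qed.

(** Gallai's exchange argument. Suppose that an optimal packing [P] misses [u] and [v]. Among the
    optimal packings that miss [t], let [N] share the most blocks with [P]. A block of [P] can be
    swapped into [N] without covering [t], which contradicts the choice of [N]. *)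
Lemma codependent_trans : {in S & &, transitive codependent}.
Proof.
move=> t u v tS uS vS; rewrite /codependent.
have [//|uv] := eqVneq u v; have [eut|ut] /= := eqVneq u t.
  by move=> _; rewrite -eut (negPf uv).
have [<- //|tv] /= := eqVneq t v.
move=> nut ntv; rewrite ltnNge; apply/negP => le.
have [P pP [PS nuE]] := nuP (S :\ u :\ v).
have cP : #|cover P| = nu S.
  apply/eqP; rewrite -nuE eqn_leq le andbT leq_nu //.
  by rewrite (subset_trans (subD1set _ _)) ?subD1set.
pose good N := [&& packing N, cover N \subset S :\ t & #|cover N| == nu S].
have [N0 gN0] : exists N, good N.
  have [N pN [NS nuN]] := nuP (S :\ t).
  by exists N; rewrite /good pN NS -nuN inessential ?eqxx.
case: (@arg_maxnP _ N0 good (fun N => #|P :&: N|) gN0) => N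
  /and3P[pN NS /eqP cN] maxN.
have tN : t \notin cover N by apply/negP => /(subsetP NS); rewrite !inE eqxx.
have covN w : w \in S -> nu (S :\ w :\ t) < nu S -> w \in cover N.
  move=> wS; apply: contraLR => wN; rewrite -leqNgt -cN nu_ge //.
  apply/subsetP => z zN; have := subsetP NS z zN; rewrite !inE => /andP[-> ->].
  by rewrite andbT; apply: contraNneq wN => <-.
have uN : u \in cover N by apply: covN.
have vN : v \in cover N by apply: covN => //; rewrite setDDl setUC -setDDl.
have [uP vP] : u \notin cover P /\ v \notin cover P.
  by split; apply/negP => /(subsetP PS); rewrite !inE eqxx ?andbF.
(* The covers of [P] and [N] have equal size, and [u], [v] lie in the second only. So at least two
   vertices lie in the first only, and one of them is not [t]. *)
have [x xP xt] : exists2 x, x \in cover P :\: cover N & x != t.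
  have c2 : 1 < #|cover P :\: cover N|.
    have -> : #|cover P :\: cover N| = #|cover N :\: cover P|.
      by rewrite !cardsD setIC cP cN.
    apply: (@leq_trans #|[set u; v]|); first by rewrite cards2 uv.
    apply: subset_leq_card; apply/subsetP => z.
    by rewrite !inE => /orP[] /eqP->; rewrite ?uP ?vP ?uN ?vN.
  have : 0 < #|(cover P :\: cover N) :\ t|.
    by move: c2; rewrite (cardsD1 t); case: (t \in _) => //; apply: ltnW.
  by case/card_gt0P => x; rewrite in_setD1 => /andP[xt xP]; exists x.
move: xP; rewrite inE => /andP[xN /bigcupP[B BP xB]].
have /andP[PF tP] := pP; have /andP[NF tNN] := pN.
have BF := subsetP PF B BP.
have BPS : B \subset cover P by exact: bigcup_sup.
have BS : B \subset S.
  apply: subset_trans BPS (subset_trans PS _).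
  by rewrite (subset_trans (subD1set _ _)) ?subD1set.
have [y BE] : exists y, B = [set x; y].
  have /cards2P[a [b [_ BE]]] : #|B| == 2 by rewrite F2.
  move: xB; rewrite BE !inE => /orP[] /eqP->; [by exists b|].
  by exists a; rewrite setUC.
have yB : y \in B by rewrite BE !inE eqxx orbT.
have BN : B \notin N.
  by apply: contra xN => BN; apply/bigcupP; exists B.
(* If [N] missed [y] as well as [x], adding [B] would beat the optimum. *)
have [yN|yN] := boolP (y \in cover N); last first.
  have dBN : [disjoint cover [set B] & cover N].
    rewrite cover1; apply/pred0P => z /=; rewrite BE !inE.
    by apply/negP => /andP[/orP[] /eqP-> zN]; [rewrite zN in xN | rewrite zN in yN].
  have pBN := packingU (packing1 BF) pN dBN.
  have : #|cover (B |: N)| <= nu S.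
    apply: nu_ge => //; rewrite coverU cover1 subUset BS.
    by rewrite (subset_trans NS) ?subD1set.
  by rewrite card_cover2 // cardsU1 BN -cN card_cover2 // mulnDl ltnNge leqnSn.
have [B' B'N yB'] := bigcupP yN.
have pN' := packingS (subD1set N B') pN.
have dBN : [disjoint cover [set B] & cover (N :\ B')].
  rewrite cover1; apply/pred0P => z /=; rewrite BE !inE.
  apply/negP => /andP[/orP[] /eqP-> /bigcupP[C]]; rewrite !inE => /andP[CB' CN] zC.
    by move/negP: xN; apply; apply/bigcupP; exists C.
  have /trivIsetP/(_ C B' CN B'N CB') := tNN.
  by move/pred0P/(_ y) => /=; rewrite zC yB'.
have pBN := packingU (packing1 BF) pN' dBN.
(* [B'] meets [B] in [y], so it is not in [P]: replacing it by [B] in [N] gains a block common with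
   [P] and loses none. *)
have B'P : B' \notin P.
  apply/negP => B'P; have BB' : B != B' by apply: contraNneq BN => ->.
  have /trivIsetP/(_ B B' BP B'P BB') := tP.
  by move/pred0P/(_ y) => /=; rewrite yB yB'.
have : good (B |: N :\ B').
  apply/and3P; split=> //.
    rewrite coverU cover1 subUset; apply/andP; split.
      rewrite subsetD1 BS BE !inE negb_or eq_sym xt.
      by apply: contraNneq tN => ->.
    apply: subset_trans NS; apply/bigcupsP => C; rewrite !inE => /andP[_ CN].
    exact: bigcup_sup.
  rewrite card_cover2 // cardsU1 !inE (negPf BN) andbF /= -cN card_cover2 //.
  by rewrite (cardsD1 B' N) B'N.
move/maxN.
have -> : P :&: (B |: N :\ B') = B |: (P :&: N).
  apply/setP => C; rewrite !inE; case: eqP => [->|_] /=; first by rewrite BP.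
  by case: eqP => [->|//]; rewrite (negPf B'P).
by rewrite /= cardsU1 inE (negPf BN) andbF add1n ltnn.
Qed.

(** Two vertices of [S] missed by an optimal packing would not be codependent, so at most one is
    missed. *)
Lemma card_codependent : {in S &, forall u v, codependent u v} ->
  #|S| <= (nu S).+1.
Proof.
move=> cd; have [P pP [PS nuE]] := nuP S.
rewrite nuE -(cardsID (cover P) S) (setIidPr PS) -addn1 leq_add2l.
apply: contraT; rewrite -ltnNge => /card_gt1P[u [v []]].
rewrite !inE => /andP[uP uS] /andP[vP vS] uv.
have := cd u v uS vS; rewrite /codependent (negPf uv) /= ltnNge nuE => /negP[].
apply: nu_ge => //; apply/subsetP => z zP; rewrite !inE (subsetP PS) // andbT.
by apply/andP; split; [apply: contraNneq vP => <-|apply: contraNneq uP => <-].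
Qed.

End Gallai.
End Pairs.

End Packings.

(** * The mean of the optimum of a random part *)

Section RandomAssignment.
Variables (R : realType) (V : finType) (k : nat) (p : 'I_k -> R).
Hypothesis p_ge0 : forall i, 0 <= p i.
Hypothesis p_sum1 : \sum_i p i = 1.
Implicit Types (S : {set V}) (f : {ffun V -> 'I_k}).

Lemma expect_card_assigned i S :
  expect p (fun f => #|S :&: assigned f i|%:R) = p i * #|S|%:R.
Proof.
have E f : #|S :&: assigned f i|%:R = \sum_(x in S) (f x == i)%:R :> R.
  rewrite -sum1_card natr_sum (eq_bigl (fun x => (x \in S) && (f x == i))).
    by rewrite big_mkcondr; apply: eq_bigr => x _; case: eqP.
  by move=> x; rewrite !inE.
rewrite (eq_expect _ E) expect_sum.
under eq_bigr => x _ do rewrite (expect_coord p_sum1 x (fun t => (t == i)%:R)).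
rewrite sumr_const mulr_natr (bigD1 i) //= eqxx mulr1 big1 ?addr0 // => j /negPf->.
by rewrite mulr0.
Qed.

(** By independence the mean factors over [S], each vertex contributing [1 - 2 * p i]. It gives the
    probability that the part is odd. *)
Lemma expect_sign_assigned i S :
  expect p (fun f => (-1) ^+ #|assigned f i :&: S|) = (1 - 2 * p i) ^+ #|S|.
Proof.
have E f : (-1) ^+ #|assigned f i :&: S|
    = \prod_x (if (x \in S) && (f x == i) then -1 else 1) :> R.
  rewrite -big_mkcond /= -prodr_const; apply: eq_bigl => x.
  by rewrite !inE andbC.
rewrite (eq_expect _ E).
rewrite (expect_prod p (fun x t => if (x \in S) && (t == i) then -1 else 1)).
rewrite -prodr_const [RHS]big_mkcond; apply: eq_bigr => x _.
case: (x \in S) => /=; last by under eq_bigr do rewrite mulr1.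
have pE : \sum_(j | j != i) p j = 1 - p i.
  by have := p_sum1; rewrite (bigD1 i) //= => <-; ring.
rewrite (bigD1 i) //= eqxx (eq_bigr p); first by rewrite pE; ring.
by move=> j /negPf->; rewrite mulr1.
Qed.

Lemma expect_nu_pairs (F : {set {set V}}) i S :
  {in F, forall A : {set V}, #|A| = 2} -> p i <= 1 / 2 ->
  expect p (fun f => (nu F (assigned f i :&: S))%:R) <= p i * (nu F S)%:R.
Proof.
move=> F2 pi2; have pi0 := p_ge0 i.
elim: {S}_.+1 {-2}S (ltnSn #|S|) => // n IH S; rewrite ltnS => Sn.
(* If every optimal packing meets [v], removing [v] lowers [nu F S] by at least 2, by parity, while
   [v] adds at most [2 * p i] to the mean. *)
have [/existsP[v /andP[vS vess]]|] :=
  boolP [exists v, (v \in S) && (nu F (S :\ v) < nu F S)%N].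
  have := IH (S :\ v).
  rewrite (leq_trans _ Sn) ?[X in (_ < X)%N](cardsD1 v) ?vS // => /(_ isT) IHv.
  have le2 : (nu F (S :\ v) + 2 <= nu F S)%N.
    rewrite addn2 ltn_neqAle vess andbT; apply: contraTneq (nu_even F2 (S :\ v)).
    by have := nu_even F2 S => ev eq; rewrite -eq /= in ev.
  have E1 : expect p (fun f => (v \in assigned f i)%:R) = p i.
    have := expect_card_assigned i [set v]; rewrite cards1 mulr1 => <-.
    apply: eq_expect => f; have [vf|vf] := boolP (v \in assigned f i).
      by rewrite (setIidPl _) ?sub1set // cards1.
    by rewrite (disjoint_setI0 _) ?cards0 // disjoints1.
  apply: (@le_trans _ _ (expect p (fun f => (nu F (assigned f i :&: (S :\ v)))%:R
      + 2 * (v \in assigned f i)%:R))).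
    apply: le_expect => // f; rewrite -natrM -natrD ler_nat.
    apply: leq_trans (nu_setD1 F2 _ v) _.
    by rewrite setIDA inE vS andbT.
  rewrite expectD expectZ E1.
  have : (nu F (S :\ v))%:R + 2 <= (nu F S)%:R :> R by rewrite -natrD ler_nat.
  by nra.
rewrite negb_exists => /forallP iness.
have {}iness v : v \in S -> nu F (S :\ v) = nu F S.
  move=> vS; apply/eqP; rewrite eqn_leq leq_nu ?subD1set //=.
  by have := iness v; rewrite vS /= -leqNgt.
have [->|[v0 v0S]] := set_0Vmem S.
  under eq_expect do rewrite setI0.
  have -> : nu F set0 = 0%N.
    by apply/eqP; have := nu_le_card F set0; rewrite cards0 leqn0.
  by rewrite expect_cst // mulr0.
(* The codependence class of [v0]. Either it is all of [S], or it splits [S] into two smaller sets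
   with no block across. *)
pose A := [set x in S | codependent F S v0 x].
have AS : A \subset S by apply/subsetP => x; rewrite inE => /andP[].
have v0A : v0 \in A by rewrite inE v0S /codependent eqxx.
have [AES|AnS] := eqVneq A S.
  have cS : (#|S| <= (nu F S).+1)%N.
    apply: card_codependent => // u v uS vS.
    apply: (codependent_trans F2 iness v0S) => //.
      by rewrite codependent_sym; move: uS; rewrite -{1}AES inE => /andP[].
    by move: vS; rewrite -{1}AES inE => /andP[].
  (* Since [nu] is even, an even [S] is covered entirely, and the trivial bound by the size of the
     part suffices. *)
  have [oS|eS] := boolP (odd #|S|); last first.
    have -> : nu F S = #|S|.
      apply/eqP; rewrite eqn_leq nu_le_card leqNgt; apply/negP => lt.
      have eqS : #|S| = (nu F S).+1 by apply/eqP; rewrite eqn_leq cS lt.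
      by move: eS; rewrite eqS /= nu_even.
    rewrite -expect_card_assigned; apply: le_expect => // f.
    by rewrite ler_nat setIC nu_le_card.
  (* The subtracted term is the parity of the part: blocks are pairs, so an odd part leaves a vertex
     uncovered. *)
  apply: (@le_trans _ _ (expect p (fun f => #|S :&: assigned f i|%:R
      - 2^-1 * (1 - (-1) ^+ #|assigned f i :&: S|)))).
    apply: le_expect => // f; rewrite (setIC S).
    set T := assigned f i :&: S.
    have := nu_le_card F T; rewrite -signr_odd.
    have [oT|eT] := boolP (odd #|T|); rewrite /= ?expr1 ?expr0.
      rewrite leq_eqVlt => /orP[/eqP eT|].
        by have := nu_even F2 T; rewrite eT oT.
      by rewrite -(ler_nat R) -natr1; nra.
    by rewrite -(ler_nat R); nra.
  rewrite expectB expectZ expectB expect_cst // expect_card_assigned.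
  rewrite expect_sign_assigned.
  have sS : (#|S|%:R - 1 <= (nu F S)%:R :> R).
    by rewrite lerBlDr natr1 ler_nat.
  (* Here [p i <= 1 / 2] puts the base in [[0, 1]]. The mean is then at most [p i * (#|S| - 1)]. *)
  have qS : (1 - 2 * p i) ^+ #|S| <= 1 - 2 * p i.
    rewrite -[leRHS]expr1; apply: ler_wiXn2l; first by nra.
      by nra.
    by rewrite (cardsD1 v0) v0S.
  by nra.
have cA : (#|A| < #|S|)%N by apply: proper_card; rewrite properEneq AnS.
have cD : (#|S :\: A| < #|S|)%N.
  rewrite cardsD (setIidPr AS) ltn_subrL; apply/andP; split; apply/card_gt0P.
    by exists v0.
  by exists v0.
have IHA := IH _ (leq_trans cA Sn); have IHD := IH _ (leq_trans cD Sn).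
apply: (@le_trans _ _ (expect p (fun f => (nu F (assigned f i :&: A))%:R
    + (nu F (assigned f i :&: (S :\: A)))%:R))).
  apply: le_expect => // f; rewrite -natrD ler_nat.
  have [P pP [PS ->]] := nuP F (assigned f i :&: S).
  pose PA := [set B in P | B \subset A].
  pose PD := [set B in P | B \subset S :\: A].
  (* The two vertices of a block are codependent, so by transitivity no block crosses the boundary
     of [A]. *)
  have PE : P = PA :|: PD.
    apply/setP => B; rewrite !inE -andb_orr; case BP: (B \in P) => //=.
    apply/esym; have BPS : B \subset assigned f i :&: S.
      by apply: subset_trans PS; exact: bigcup_sup.
    have BS : B \subset S by apply: subset_trans BPS (subsetIr _ _).
    have BF : B \in F by case/andP: pP => /subsetP/(_ B BP).
    have cB := codependent_edge F2 BF BS.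
    have [//|/subsetPn[x xB xA]] := boolP (B \subset A).
    apply/subsetP => y yB; rewrite inE (subsetP BS) // andbT.
    apply: contra xA; rewrite !inE => /andP[yS v0y]; rewrite (subsetP BS) //=.
    by apply: (codependent_trans F2 iness yS) => //; [exact: (subsetP BS)|exact: cB].
  have pPA : packing F PA by apply: packingS pP; rewrite PE subsetUl.
  have pPD : packing F PD by apply: packingS pP; rewrite PE subsetUr.
  rewrite PE coverU (leq_trans (leq_card_setU _ _)) // leq_add //.
    apply: nu_ge => //; apply/bigcupsP => B; rewrite inE => /andP[BP BA].
    rewrite subsetI BA andbT; apply: subset_trans (subsetIl _ S).
    by apply: subset_trans PS; exact: bigcup_sup.
  apply: nu_ge => //; apply/bigcupsP => B; rewrite inE => /andP[BP BA].
  rewrite subsetI BA andbT; apply: subset_trans (subsetIl _ S).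
  by apply: subset_trans PS; exact: bigcup_sup.
rewrite expectD; apply: le_trans (lerD IHA IHD) _.
rewrite -mulrDr ler_wpM2l // -natrD ler_nat.
apply: leq_trans (leq_nuU _ _) _.
  by rewrite disjoint_sym disjoints_subset setDE subsetIr.
by rewrite leq_nu // subUset AS subsetDl.
Qed.

End RandomAssignment.

(** * Probabilities with integer inverse *)

Section UniformAssignment.
Variables (R : realType) (V : finType).

(** The law of one class depends on [p i] alone, which allows a comparison with another set of
    players. *)
Lemma expect_assigned (k : nat) (p : 'I_k -> R) i (phi : {set V} -> R) :
  \sum_i p i = 1 ->
  expect p (fun f : {ffun V -> 'I_k} => phi (assigned f i))
  = \sum_(S : {set V}) (\prod_x (if x \in S then p i else 1 - p i)) * phi S.
Proof.
move=> p_sum1.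
rewrite /expect (partition_big (fun f => assigned f i) predT) //=.
apply: eq_bigr => S _.
under eq_bigr => f /eqP-> do [].
rewrite -mulr_suml; congr (_ * _).
(* The assignments with class [S] form a product family, so their total weight factors over the
   vertices. *)
pose Q x := [pred t : 'I_k | (t == i) == (x \in S)].
have -> : \prod_x (if x \in S then p i else 1 - p i)
    = \prod_x \sum_(t | Q x t) p t.
  apply: eq_bigr => x _; case xS: (x \in S).
    rewrite (eq_bigl (pred1 i)) ?big_pred1_eq // => t.
    by rewrite /= xS; case: (t == i).
  have := p_sum1; rewrite (bigD1 i) //= => <-.
  rewrite addrAC subrr add0r; apply: eq_bigl => t.
  by rewrite /= xS eqbF_neg.
rewrite bigA_distr_big_dep; apply: eq_bigl => f.
apply/eqP/familyP => [fS x|fS]; first by rewrite inE /= -fS inE eqxx.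
by apply/setP => x; have := fS x; rewrite !inE => /eqP.
Qed.

(* Compare player [i] with one class of a uniform colouring with [1 / p i]
   colours; the classes are disjoint and exchangeable. *)
Lemma expect_nu_uniform (k : nat) (p : 'I_k -> R) (F : {set {set V}}) i :
  \sum_i p i = 1 -> 0 < p i -> (p i)^-1 \is a Num.int ->
  expect p (fun f => (nu F (assigned f i))%:R) <= p i * (nu F setT)%:R.
Proof.
move=> p_sum1 pi0 /intrP[z zE].
have [m mE] : exists m : nat, (p i)^-1 = m%:R.
  exists `|z|%N; rewrite zE; case: z zE => // n zE.
  by move: pi0; rewrite -invr_gt0 zE NegzE ltr0z.
have m0 : m%:R != 0 :> R by rewrite -mE invr_eq0 gt_eqF.
have piE : p i = m%:R^-1 by rewrite -mE invrK.
pose q (_ : 'I_m) : R := p i.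
have q_sum1 : \sum_j q j = 1.
  by rewrite sumr_const card_ord -mulr_natr piE mulVf.
have : \sum_(j < m) expect q (fun f => (nu F (assigned f j))%:R)
    <= (nu F setT)%:R.
  rewrite -expect_sum -[leRHS](expect_cst V q_sum1).
  apply: le_expect => [j|f]; first exact: ltW.
  by rewrite -natr_sum ler_nat leq_nu_sum.
under eq_bigr => j _ do rewrite (expect_assigned j (fun S => (nu F S)%:R) q_sum1).
rewrite /q sumr_const card_ord (expect_assigned i (fun S => (nu F S)%:R) p_sum1).
move=> le; rewrite [X in _ <= X * _]piE ler_pdivlMl; first by rewrite mulr_natl.
by rewrite lt0r m0 ler0n.
Qed.

End UniformAssignment.

(** * Cycle matchings as set packings *)

Section CycleSets.
Variables (r : cycle_restriction) (V : finType) (e : rel V).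
Local Open Scope nat_scope.

(** The number of covered vertices depends only on the vertex sets of the cycles, so matchings can
    be handled as packings of these sets. *)
Definition cycle_sets : {set {set V}} :=
  [set A | `[< exists c, [/\ allowed_length r (size c), cycle e c, uniq c
                           & A = [set x in c]] >]].

Lemma cycle_setsP (A : {set V}) :
  reflect (exists c, [/\ allowed_length r (size c), cycle e c, uniq c
                       & A = [set x in c]])
          (A \in cycle_sets).
Proof. by rewrite inE; apply: asboolP. Qed.

Lemma card_set_seq (c : seq V) : uniq c -> #|[set x in c]| = size c.
Proof. by move=> uc; rewrite cardsE; apply/card_uniqP. Qed.

Lemma card_cycle_sets :
  {in cycle_sets, forall A : {set V}, #|A| <= max_cycle_length r}.
Proof.
move=> A /cycle_setsP[c [ac _ uc ->]]; rewrite card_set_seq //.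
by move: ac; case: r => [/eqP->|L /andP[]].
Qed.

Lemma packing_of_matching M : is_matching r e M ->
  exists2 P, packing cycle_sets P & cover P = covered M.
Proof.
elim: M => [|c M IH].
  move=> _; exists set0; first exact: packing0.
  by rewrite /covered /cover big_set0 -[RHS]set_nil.
rewrite /is_matching /= cat_uniq -!andbA => /and5P[ac cc aM uc /andP[dcM uM]].
have [|P pP PE] := IH; first by rewrite /is_matching aM.
have cF : [set x in c] \in cycle_sets by apply/cycle_setsP; exists c.
exists ([set x in c] |: P).
  apply: packingU => //; first exact: packing1.
  rewrite cover1 PE; apply/pred0P => x /=; rewrite !inE.
  by apply: contraNF dcM => /andP[xc xM]; apply/hasP; exists x.
by rewrite coverU cover1 PE; apply/setP => x; rewrite !inE mem_cat.
Qed.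

Lemma matching_of_packing P : packing cycle_sets P ->
  exists2 M, is_matching r e M & covered M = cover P.
Proof.
elim: {P}_.+1 {-2}P (ltnSn #|P|) => // n IH P; rewrite ltnS => Pn pP.
have [->|[A AP]] := set_0Vmem P.
  by exists [::] => //; rewrite /cover big_set0; apply/setP => x; rewrite !inE.
have [||M mM ME] := IH (P :\ A).
- by rewrite (leq_trans _ Pn) // [X in _ < X](cardsD1 A) AP.
- exact: packingS (subD1set _ _) pP.
have /andP[PF tP] := pP.
have /cycle_setsP[c [ac cc uc AE]] := subsetP PF A AP.
have PE : cover P = A :|: cover (P :\ A) by rewrite -{1}(setD1K AP) coverU cover1.
exists (c :: M); last first.
  by rewrite PE -ME AE; apply/setP => x; rewrite !inE mem_cat.
have /andP[aM uM] := mM.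
rewrite /is_matching /= ac cc aM cat_uniq uc uM /= andbT.
apply/hasPn => x xM; apply/negP => xc.
have : x \in cover (P :\ A) by rewrite -ME inE.
case/bigcupP => B; rewrite !inE => /andP[BA BP] xB.
have /trivIsetP/(_ B A BP AP BA)/pred0P/(_ x) := tP.
by rewrite /= xB AE inE xc.
Qed.

Lemma card_covered_maximum M : is_maximum_matching r e M ->
  #|covered M| = nu cycle_sets setT.
Proof.
case=> mM maxM; apply/eqP; rewrite eqn_leq; apply/andP; split.
  by have [P pP <-] := packing_of_matching mM; rewrite nu_ge ?subsetT.
have [P pP [_ ->]] := nuP cycle_sets setT.
by have [M' mM' <-] := matching_of_packing pP; apply: maxM.
Qed.

(** Cycles of the induced graph are pushed forward along [val] to cycles inside [S]. *)
Lemma opt_size_induced (S : {set V}) :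
  opt_size r (induced e S) <= nu cycle_sets S.
Proof.
apply/bigmax_leqP => T /asboolP[M /andP[aM uM] ->].
pose M' := map (map val) M.
have uM' : uniq (flatten M').
  by rewrite -map_flatten map_inj_uniq //; apply: val_inj.
have mM' : is_matching r e M'.
  rewrite /is_matching uM' andbT all_map; apply: sub_all aM => c /=.
  by rewrite size_map cycle_map.
have [P pP PE] := packing_of_matching mM'.
have -> : #|covered M| = #|cover P|.
  rewrite PE card_set_seq // -map_flatten size_map cardsE.
  exact/card_uniqP.
apply: nu_ge => //; rewrite PE; apply/subsetP => x.
by rewrite inE -map_flatten => /mapP[y _ ->]; apply: valP.
Qed.

End CycleSets.

Lemma card_two_cycle_sets (V : finType) (e : rel V) :
  {in cycle_sets TwoCycles e, forall A : {set V}, #|A| = 2%N}.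
Proof.
by move=> A /cycle_setsP[c [/eqP c2 _ uc ->]]; rewrite card_set_seq.
Qed.

(** * Gaussian upper tail from weighted certificates *)

Section Tail.
Variables (R : realType) (V : finType) (k : nat) (p : 'I_k -> R).
Hypothesis p_ge0 : forall i, 0 <= p i.
Hypothesis p_sum1 : \sum_i p i = 1.
Implicit Types (f : {ffun V -> 'I_k}).

Lemma assignment_PrE (E : pred {ffun V -> 'I_k}) :
  assignment_Pr p E = expect p (fun f => (E f)%:R).
Proof.
rewrite /assignment_Pr big_mkcond; apply: eq_bigr => f _.
by case: (E f); rewrite ?mulr1 ?mulr0.
Qed.

(** Chernoff's method: [expect_exp_certificate] for [b * h] with weights [b * a] bounds the mean of
    [expR (b * h)] by [expR (b ^+ 2 * c)]. The choice of [b] is the square root of [l / c]. *)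
Lemma tail_bound (h : {ffun V -> 'I_k} -> R) (a : V -> {ffun V -> 'I_k} -> R)
    (c l : R) :
  (forall j f, 0 <= a j f) ->
  (forall f f', h f - \sum_(j | f j != f' j) a j f <= h f') ->
  (forall f, \sum_j a j f ^+ 2 <= c) ->
  expect p h <= 0 -> 0 < c -> 0 <= l ->
  expect p (fun f => (2 * Num.sqrt (c * l) < h f)%R%:R) <= expR (- l).
Proof.
move=> a0 ha ac Eh c0 l0.
set s := Num.sqrt (c * l); pose b := s / c.
have s0 : 0 <= s by exact: sqrtr_ge0.
have b0 : 0 <= b by rewrite divr_ge0 // ltW.
have sb : s = b * c by rewrite /b divfK // gt_eqF.
have ss : b * s = l.
  have s2 : s ^+ 2 = c * l by rewrite sqr_sqrtr // mulr_ge0 // ltW.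
  by rewrite /b mulrAC -expr2 s2 mulrAC divff ?gt_eqF // mul1r.
have cert := @expect_exp_certificate R V 'I_k p p_ge0 p_sum1 (index_enum V)
  (fun f => b * h f) (fun f => b * h f) (fun j f => b * a j f) (index_enum_uniq V).
have {cert} le1 : expect p (fun f => expR (b * h f - b ^+ 2 * c)) <= 1.
  apply: le_trans (_ : _ <= expR (expect p (fun f => b * h f))) _; last first.
    by rewrite expR_le1 expectZ mulr_ge0_le0.
  apply: le_trans (cert _ _).
  - apply: le_expect => // f; rewrite ler_expR lerD2l lerN2.
    under eq_bigr do rewrite exprMn.
    by rewrite -mulr_sumr ler_wpM2l ?sqr_ge0.
  - by move=> j f; rewrite mulr_ge0.
  - by move=> f f'; rewrite -mulr_sumr -mulrBr ler_wpM2l.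
rewrite expRN -[leRHS]mul1r ler_pdivlMr ?expR_gt0 // mulrC -expectZ.
apply: le_trans le1; apply: le_expect => // f.
case: ltP => [hs|_]; last by rewrite mulr0 expR_ge0.
rewrite mulr1 ler_expR.
(* [b * h f >= 2 * b * s = 2 * l], and [b ^+ 2 * c = b * s = l]. *)
by nra.
Qed.

End Tail.

(** * Tail of the excess of a player *)

Section PlayerTail.
Variables (R : realType) (V : finType) (k : nat) (p : 'I_k -> R).
Hypothesis p_ge0 : forall i, 0 <= p i.
Hypothesis p_sum1 : \sum_i p i = 1.
Variables (F : {set {set V}}) (L : nat) (O : {set V}) (i : 'I_k).
Hypothesis F_le : {in F, forall A : {set V}, (#|A| <= L)%N}.
Hypothesis card_O : #|O| = nu F setT.
Hypothesis expect_nu_le :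
  expect p (fun f => (nu F (assigned f i))%:R) <= p i * (nu F setT)%:R.
Implicit Types (f : {ffun V -> 'I_k}).

Definition excess f : R := (nu F (assigned f i))%:R - #|O :&: assigned f i|%:R.

Definition optimal_cover f : {set V} := cover (s2val (nuP F (assigned f i))).

(** Reassigning [j] destroys at most one block of the packing chosen at [f], hence [L] vertices, and
    changes the part of [O] by at most one. The weight depends on [f] alone, as the certificate
    requires. *)
Definition sensitivity (j : V) f : R :=
  L%:R * (j \in optimal_cover f)%:R + (j \in O)%:R.

Lemma excess_certificate f f' :
  excess f - \sum_(j | f j != f' j) sensitivity j f <= excess f'.
Proof.
rewrite /excess /sensitivity /optimal_cover.
case: (nuP F (assigned f i)) => P pP [PS nuE] /=.
rewrite big_split /= -mulr_sumr -!natr_sum.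
set D1 := (\sum_(j | f j != f' j) (j \in cover P))%N.
set D2 := (\sum_(j | f j != f' j) (j \in O))%N.
have h1 : (nu F (assigned f i) <= nu F (assigned f' i) + L * D1)%N.
  rewrite nuE (leq_trans (nu_certificate (assigned f' i) F_le pP)) //.
  rewrite leq_add2l leq_mul2l; apply/orP; right.
  rewrite /D1 -sum1_card big_mkcond [leqRHS]big_mkcond /=; apply: leq_sum => j _.
  rewrite !inE; case jP: (j \in cover P); last by rewrite andbF.
  have := subsetP PS j jP; rewrite inE => /eqP->; rewrite andbT eq_sym.
  by case: eqP.
have h2 : (#|O :&: assigned f' i| <= #|O :&: assigned f i| + D2)%N.
  rewrite /D2 -!sum1_card big_mkcond [X in (_ <= X + _)%N]big_mkcond.
  rewrite [X in (_ <= _ + X)%N]big_mkcond -big_split /=; apply: leq_sum => j _.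
  rewrite !inE; case: (j \in O) => //=.
  by case: (f' j =P i) => [->|_] //; case: (f j =P i).
move: h1 h2; rewrite -!(ler_nat R) !natrD natrM.
by lra.
Qed.

Lemma sum_sensitivity_sqr f :
  \sum_j sensitivity j f ^+ 2 <= (L%:R + 1) ^+ 2 * #|O|%:R.
Proof.
rewrite /sensitivity /optimal_cover.
case: (nuP F (assigned f i)) => P pP [PS nuE] /=.
(* Indicators are idempotent, and the cross term is bounded by [2 * L%:R] on the optimal cover,
   whose size is at most [#|O|]. *)
have le j : (L%:R * (j \in cover P)%:R + (j \in O)%:R) ^+ 2 <=
    (L%:R ^+ 2 + 2 * L%:R) * (j \in cover P)%:R + (j \in O)%:R :> R.
  have L0 : 0 <= L%:R :> R by exact: ler0n.
  by case: (j \in cover P); case: (j \in O) => /=; nra.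
apply: le_trans (ler_sum _ (fun j _ => le j)) _.
rewrite big_split /= -mulr_sumr -!natr_sum.
have card_sum (A : {set V}) : (\sum_j (j \in A) = #|A|)%N.
  by rewrite -sum1_card [RHS]big_mkcond; apply: eq_bigr => j _; case: (j \in A).
rewrite !card_sum.
have : #|cover P|%:R <= #|O|%:R :> R.
  by rewrite ler_nat card_O nu_ge ?subsetT.
have L0 : 0 <= L%:R :> R by exact: ler0n.
by nra.
Qed.

Lemma excess_tail (l : R) : 0 <= l ->
  expect p (fun f => (2 * (L%:R + 1) * Num.sqrt (#|O|%:R * l) < excess f)%R%:R)
  <= expR (- l).
Proof.
(* [tail_bound] needs a positive variance. If [O] is empty then [nu] vanishes and the excess is
   never positive. *)
move=> l0; have [O0|O_gt0] := posnP #|O|.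
  rewrite O0 mul0r sqrtr0 mulr0 (@eq_expect _ _ _ p _ (fun=> 0)).
    by rewrite expect_cst ?expR_ge0.
  move=> f; rewrite /excess.
  have -> : nu F (assigned f i) = 0%N.
    by apply/eqP; rewrite -leqn0 -O0 card_O leq_nu ?subsetT.
  by rewrite sub0r oppr_gt0 ltNge ler0n.
have L0 : 0 <= L%:R + 1 :> R by rewrite addr_ge0.
have sE : 2 * (L%:R + 1) * Num.sqrt (#|O|%:R * l)
    = 2 * Num.sqrt ((L%:R + 1) ^+ 2 * #|O|%:R * l).
  rewrite -[_ ^+ 2 * _ * l]mulrA [in RHS]sqrtrM ?sqr_ge0 //.
  by rewrite sqrtr_sqr ger0_norm // mulrA.
rewrite sE; apply: (tail_bound p_ge0 p_sum1 (a := sensitivity)) => //.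
- by move=> j f; rewrite addr_ge0 ?mulr_ge0.
- exact: excess_certificate.
- exact: sum_sensitivity_sqr.
(* The mean of [#|O :&: assigned f i|] is [p i * nu F setT], so the excess has mean at most 0. *)
- rewrite /excess expectB expect_card_assigned // card_O subr_le0.
  exact: expect_nu_le.
- by rewrite mulr_gt0 ?ltr0n // exprn_gt0 // ltr_wpDl.
Qed.

End PlayerTail.

(** * Union bound over the players *)

Theorem theorem1 (R : realType) :
  exists C : nat -> R,
  forall (r : cycle_restriction) (V : finType) (e : rel V) (M : seq (seq V))
         (k : nat) (p : 'I_k -> R) (delta : R),
    is_maximum_matching r e M ->
    (forall i, 0 <= p i) ->
    \sum_(i < k) p i = 1 ->
    (r = TwoCycles /\ (forall i, p i <= 1 / 2))
    \/ (exists L : nat, r = CyclesUpTo L /\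
          (forall i, 0 < p i /\ (p i)^-1 \is a Num.int)) ->
    0 < delta ->
    1 - delta <=
      assignment_Pr p (fun f : {ffun V -> 'I_k} =>
        [forall i : 'I_k,
           (opt_size r (induced e (assigned f i)))%:R
             - #|covered M :&: assigned f i|%:R
           <= C (max_cycle_length r)
              * Num.sqrt (#|covered M|%:R * ln (k%:R / delta))]).
Proof.
exists (fun L => 2 * (L%:R + 1)) => r V e M k p delta maxM p0 p1 hyp delta0.
set good := (fun f => _); rewrite assignment_PrE.
(* For [delta >= 1] the claim is trivial; otherwise [k%:R / delta >= 1] and the logarithm is
   nonnegative. *)
have [delta1|delta1] := leP 1 delta.
  apply: (@le_trans _ _ 0); first by rewrite subr_le0.
  by rewrite -(expect_cst V p1 0); apply: le_expect.
have k0 : (0 < k)%N.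
  case: k p p0 p1 {hyp good} => // p _.
  by rewrite big_ord0 => /eqP; rewrite eq_sym oner_eq0.
set l := ln (k%:R / delta).
have kd : 1 <= k%:R / delta.
  rewrite ler_pdivlMr // mul1r (le_trans (ltW delta1)) //.
  by rewrite (ler_nat R 1 k).
have l0 : 0 <= l by exact: ln_ge0.
(* This [l] makes each player fail with probability at most [delta / k%:R]. *)
have El : expR (- l) = delta / k%:R.
  by rewrite expRN lnK ?posrE ?(lt_le_trans ltr01) // invf_div.
pose F := cycle_sets r e.
have nuE i : expect p (fun f => (nu F (assigned f i))%:R)
    <= p i * (nu F setT)%:R.
  case: hyp => [[rE p2]|[L [_ /(_ i)[pi0 pint]]]]; last exact: expect_nu_uniform.
  have F2 : {in F, forall A : {set V}, #|A| = 2%N}.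
    by rewrite /F rE; exact: card_two_cycle_sets.
  apply: le_trans (expect_nu_pairs p0 p1 setT F2 (p2 i)).
  by apply: le_expect => // f; rewrite setIT.
have tail i := excess_tail p0 p1 (@card_cycle_sets r V e)
  (card_covered_maximum maxM) (nuE i) l0.
pose t : R := 2 * ((max_cycle_length r)%:R + 1)
  * Num.sqrt (#|covered M|%:R * l).
(* Pointwise union bound. Since [opt_size] is at most [nu], a failing player has a large excess. *)
have bad f : 1 - (good f)%:R <=
    \sum_i (t < excess R F (covered M) i f)%R%:R :> R.
  rewrite /good; case: forallP => [_|H].
    by rewrite subrr sumr_ge0.
  have [i hi] : exists i, t < excess R F (covered M) i f.
    apply/existsP; apply: contraPT H; rewrite negb_exists => /forallP H; apply => i.
    have := H i; rewrite -leNgt; apply: le_trans.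
    by rewrite /excess lerB // ler_nat opt_size_induced.
  by rewrite subr0 (bigD1 i) //= hi lerDl sumr_ge0.
have : expect p (fun f => 1 - (good f)%:R) <= delta.
  apply: le_trans (le_expect p0 bad) _; rewrite expect_sum.
  apply: le_trans (ler_sum _ (fun i _ => tail i)) _.
  rewrite sumr_const card_ord El -(mulr_natr (_ / _)) divfK //.
  by rewrite pnatr_eq0 -lt0n.
by rewrite expectB expect_cst // lerBlDr lerBlDl.
Qed.
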